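(* Let $r\geq 1$ and $d\geq 2$ be integers and let $b:\mathbb{N}\to(0,\infty)$ be any function with $b(n)\to\infty$ as $n\to\infty$. For an $(r+1)$-uniform linear hypergraph $G$ with maximum degree $d$ on $n$ vertices, let $\mathcal{I}(G)$ be the independent set produced by the randomized greedy algorithm. Then $$\sup_G\ \mathbb{P}\Big[\big||\mathcal{I}(G)|-\mathbb{E}[|\mathcal{I}(G)|]\big|>\sqrt{n}\,b(n)\Big]\to 0\quad\text{as } n\to\infty,$$ where the supremum is over all $(r+1)$-uniform linear hypergraphs $G$ on $n$ vertices with maximum degree $d$.
   Context: A hypergraph is a pair $(V,E)$ with $V$ a finite set and $E$ a family of nonempty subsets of $V$; it is $(r+1)$-uniform if all edges have size $r+1$, and linear if any two distinct edges share at most one vertex. The degree of a vertex is the number of edges containing it. An independent set is a vertex subset containing no edge. The randomized greedy algorithm: maintain a set $S$ of selected vertices (initially empty) and a set $R$ of remaining vertices (initially $V$); while $R\neq\emptyset$, choose $v\in R$ uniformly at random, add $v$ to $S$, remove $v$ from $R$, and remove from $R$ every vertex $w$ for which some edge $e$ satisfies $e\subseteq S\cup\{w\}$. The output is $\mathcal{I}(G)=S$. *)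

(* Defs.v *)
From HB Require Import structures.
From mathcomp Require Import all_boot all_order all_algebra.

Set Implicit Arguments.
Unset Strict Implicit.
Unset Printing Implicit Defensive.

Import Order.TTheory GRing.Theory Num.Theory.
Local Open Scope ring_scope.

Record hypergraph (T : finType) := Hypergraph {
  edges : {set {set T}};
  edges_nonempty : forall e, e \in edges -> e != set0
}.

Definition uniform (T : finType) (k : nat) (G : hypergraph T) : Prop :=
  forall e, e \in edges G -> #|e| = k.

Definition linear_hypergraph (T : finType) (G : hypergraph T) : Prop :=
  forall e f, e \in edges G -> f \in edges G -> e != f -> (#|e :&: f| <= 1)%N.

Definition degree (T : finType) (G : hypergraph T) (v : T) : nat :=
  #|[set e in edges G | v \in e]|.

Definition max_degree (T : finType) (G : hypergraph T) : nat :=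
  (\max_(v : T) degree G v)%N.

Definition independent (T : finType) (G : hypergraph T) (S : {set T}) : Prop :=
  forall e, e \in edges G -> ~~ (e \subset S).

(* The remaining set after the step that selects [v]; [S] is the selected set
   before that step. *)
Definition remaining_after (T : finType) (G : hypergraph T)
    (S Rem : {set T}) (v : T) : {set T} :=
  [set w in Rem :\ v | ~~ [exists e in edges G, e \subset (v |: S) :|: [set w]]].

(* [greedy_from R G k S Rem] is the probability mass function of the output of
   the algorithm run for at most [k] steps from the state [(S, Rem)]. Each step
   removes a vertex from [Rem], so the bound is immaterial once [#|Rem| <= k];
   see [greedy_from_fuel]. *)
Fixpoint greedy_from (R : realFieldType) (T : finType) (G : hypergraph T)
    (k : nat) (S Rem : {set T}) : {set T} -> R :=
  fun I =>
    if Rem == set0 then (I == S)%:R else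
    if k is k'.+1 then
      #|Rem|%:R^-1 *
        \sum_(v in Rem) greedy_from R G k' (v |: S) (remaining_after G S Rem v) I
    else (I == S)%:R.

Definition greedy_law (R : realFieldType) (T : finType) (G : hypergraph T) :
    {set T} -> R :=
  greedy_from R G #|T| set0 [set: T].

(* Probability of the event [I(G) \in A], and expectation of [f (I(G))]. *)
Definition greedy_prob (R : realFieldType) (T : finType) (G : hypergraph T)
    (A : pred {set T}) : R :=
  \sum_(S : {set T} | A S) greedy_law R G S.

Definition greedy_mean (R : realFieldType) (T : finType) (G : hypergraph T)
    (f : {set T} -> R) : R :=
  \sum_(S : {set T}) greedy_law R G S * f S.

Section Facts.
Variables (R : realFieldType) (T : finType) (G : hypergraph T).
Implicit Types (S Rem I : {set T}).

Lemma remaining_after_card S Rem v :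
  v \in Rem -> (#|remaining_after G S Rem v| < #|Rem|)%N.
Proof.
move=> vR; rewrite (cardsD1 v Rem) vR add1n ltnS; apply: subset_leq_card.
by apply/subsetP => w; rewrite inE => /andP[].
Qed.

Lemma greedy_from_fuel k k' S Rem I :
  (#|Rem| <= k)%N -> (#|Rem| <= k')%N ->
  greedy_from R G k S Rem I = greedy_from R G k' S Rem I.
Proof.
elim: k k' S Rem => [|k IH] [|k'] S Rem //=.
- by rewrite leqn0 cards_eq0 => ->.
- by move=> _; rewrite leqn0 cards_eq0 => ->.
- case: eqP => // _ h h'; congr (_ * _); apply: eq_bigr => v vR.
  by apply: IH; rewrite -ltnS; apply: leq_trans (remaining_after_card S vR) _.
Qed.

Lemma greedy_from_ge0 k S Rem I : 0 <= greedy_from R G k S Rem I.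
Proof.
elim: k S Rem => [|k IH] S Rem /=; case: ifP => _; rewrite ?ler0n //.
by rewrite mulr_ge0 ?invr_ge0 ?ler0n // sumr_ge0.
Qed.

Lemma greedy_from_sum1 k S Rem : \sum_I greedy_from R G k S Rem I = 1.
Proof.
have dirac S0 : \sum_I (I == S0)%:R = 1 :> R.
  by rewrite (bigD1 S0) //= eqxx big1 ?addr0 // => I /negbTE ->.
elim: k S Rem => [|k IH] S Rem /=; case: eqP => // /eqP Rn0.
rewrite -mulr_sumr exchange_big /= (eq_bigr (fun=> 1)); last by move=> v _.
by rewrite sumr_const mulVf // pnatr_eq0 cards_eq0.
Qed.

Lemma greedy_law_ge0 I : 0 <= greedy_law R G I.
Proof. exact: greedy_from_ge0. Qed.

Lemma greedy_law_sum1 : \sum_I greedy_law R G I = 1.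
Proof. exact: greedy_from_sum1. Qed.

Lemma greedy_prob_ge0 (A : pred {set T}) : 0 <= greedy_prob R G A.
Proof. by apply: sumr_ge0 => I _; exact: greedy_law_ge0. Qed.

Lemma greedy_prob_le1 (A : pred {set T}) : greedy_prob R G A <= 1.
Proof.
rewrite -greedy_law_sum1 (bigID A) /= lerDl.
by apply: sumr_ge0 => I _; exact: greedy_law_ge0.
Qed.

Lemma greedy_from_independent k S Rem I :
  independent G S ->
  (forall v, v \in Rem -> independent G (v |: S)) ->
  greedy_from R G k S Rem I != 0 -> independent G I.
Proof.
have dirac S0 : independent G S0 -> (I == S0)%:R != 0 :> R -> independent G I.
  by move=> ind0; case: (I =P S0) => [-> //|_]; rewrite mulr0n eqxx.
elim: k S Rem => [|k IH] S Rem indS indR /=; case: ifP => _; try exact: dirac.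
rewrite mulf_eq0 negb_or => /andP[_].
have [/existsP[v /andP[vR ne0]] _|] :=
  boolP [exists v, (v \in Rem) &&
    (greedy_from R G k (v |: S) (remaining_after G S Rem v) I != 0)].
  apply: IH ne0 => [|w]; first exact: indR.
  rewrite inE => /andP[_ /existsPn h] e eG.
  by have := h e; rewrite eG /= setUC.
move/existsPn => h; rewrite big1 ?eqxx // => v vR.
by have := h v; rewrite vR /= negbK => /eqP.
Qed.

Lemma greedy_law_independent r I :
  (0 < r)%N -> uniform r.+1 G -> greedy_law R G I != 0 -> independent G I.
Proof.
move=> r0 unif; apply: greedy_from_independent => [|v _] e eG;
  apply/negP => /subset_leq_card; rewrite (unif e eG) ?cards0 //.
by rewrite setU0 cards1 ltnS leqNgt r0.
Qed.

End Facts.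

(* Main.v *)
(** Processing all vertices in a uniformly random order and skipping those that
    cannot be added gives the same output law as the greedy algorithm. Run two
    such scans along the same order, one of them being denied a vertex [v]: a
    discrepancy at a vertex must come from an earlier discrepancy at one of its
    neighbours, so the expected final discrepancy is at most the expected number
    of increasing paths issued from [v], that is at most
    [\sum_j Delta ^ j / j! <= exp Delta], where [Delta = d r] bounds the number
    of neighbours. Hence the conditional means of the output size form a
    martingale with increments bounded by [exp Delta], the variance of the size
    is at most [n exp(Delta) ^ 2], and Chebyshev's inequality gives the bound
    [(exp Delta / b n) ^ 2], uniformly in [G]. *)

Require Import Defs.
From mathcomp Require Import all_boot all_order all_algebra.
From mathcomp Require Import ring.

Set Implicit Arguments.
Unset Strict Implicit.
Unset Printing Implicit Defensive.

Import Order.TTheory GRing.Theory Num.Theory.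
Local Open Scope ring_scope.

Lemma setD1C (T : finType) (A : {set T}) x y : A :\ x :\ y = A :\ y :\ x.
Proof. by rewrite !setDDl setUC. Qed.

Lemma setD1_ind (T : finType) (P : {set T} -> Prop) :
  (forall A : {set T}, (forall x, x \in A -> P (A :\ x)) -> P A) ->
  forall A, P A.
Proof.
move=> PD1 A; have [n] := ubnP #|A|; elim: n A => // n IH A cardA.
by apply: PD1 => x xA; apply: IH; move: cardA; rewrite (cardsD1 x A) xA.
Qed.

Lemma exchange_big_setD1 (V : nmodType) (T : finType) (A : {set T})
    (P : pred T) (F : T -> T -> V) :
  \sum_(x in A) \sum_(y in A :\ x | P y) F x y =
  \sum_(y in A | P y) \sum_(x in A :\ y) F x y.
Proof.
rewrite (exchange_big_dep (fun y => (y \in A) && P y)) /=; last first.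
  by move=> x y xA /andP[/setD1P[_ ->] ->].
apply: eq_bigr => y /andP[yA Py]; apply: eq_bigl => x.
by rewrite !inE yA Py eq_sym !andbT andbC.
Qed.

Lemma big_permutations_enum (V : nmodType) (T : finType) (A : {set T})
    (F : seq T -> V) : A != set0 ->
  \sum_(o <- permutations (enum A)) F o =
  \sum_(x in A) \sum_(o <- permutations (enum (A :\ x))) F (x :: o).
Proof.
move=> A0; have size_gt0 : (0 < size (enum A))%N by rewrite -cardE card_gt0.
rewrite (perm_big _ (permutationsE size_gt0)) big_allpairs_dep.
rewrite undup_id ?enum_uniq // big_enum; apply: eq_bigr => x _.
apply: perm_big; apply: perm_permutations; apply: uniq_perm;
  rewrite ?rem_uniq ?enum_uniq // => y.
by rewrite mem_rem_uniq ?enum_uniq // mem_enum !inE mem_enum.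
Qed.

Lemma sum_sqr_dist_mean (R : realFieldType) (T : finType) (A : {set T})
    (f : T -> R) (m c : R) : \sum_(x in A) f x = #|A|%:R * m ->
  \sum_(x in A) (f x - c) ^+ 2 =
  \sum_(x in A) (f x - m) ^+ 2 + #|A|%:R * (m - c) ^+ 2.
Proof.
move=> sum_f; rewrite [RHS]addrC; apply/eqP; rewrite -subr_eq -sumrB; apply/eqP.
transitivity (\sum_(x in A) (2 * (m - c) * f x + (c ^+ 2 - m ^+ 2))).
  by apply: eq_bigr => x _; ring.
by rewrite big_split /= -mulr_sumr sum_f sumr_const -mulr_natl; ring.
Qed.

Lemma leq_card_bigcup (I T : finType) (P : pred I) (A : I -> {set T}) :
  (#|\bigcup_(i | P i) A i| <= \sum_(i | P i) #|A i|)%N.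
Proof.
elim/big_rec2: _ => [|i m B _ cardB]; first by rewrite cards0.
by apply: leq_trans (leq_card_setU _ _) _; rewrite leq_add2l.
Qed.

Section ScanMean.
Variables (R : realFieldType) (T : finType).
Implicit Types U W : {set T}.

Definition scan_mean (St : Type) (step : St -> T -> St) (s : St) U
    (F : St -> R) : R :=
  (#|U|`!)%:R^-1 * \sum_(o <- permutations (enum U)) F (foldl step s o).

Lemma ler_dist_scan_mean (St1 St2 St : Type) (step1 : St1 -> T -> St1)
    (step2 : St2 -> T -> St2) (step : St -> T -> St) s1 s2 s U F1 F2 F :
  (forall o, `|F1 (foldl step1 s1 o) - F2 (foldl step2 s2 o)| <=
             F (foldl step s o)) ->
  `|scan_mean step1 s1 U F1 - scan_mean step2 s2 U F2| <= scan_mean step s U F.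
Proof.
move=> distF; rewrite -mulrBr -sumrB normrM ger0_norm ?invr_ge0 ?ler0n //.
rewrite ler_wpM2l ?invr_ge0 ?ler0n //.
by apply: le_trans (ler_norm_sum _ _ _) (ler_sum _ _) => o _; exact: distF.
Qed.

Variable St : Type.
Implicit Types (step : St -> T -> St) (s : St) (F : St -> R).

Lemma scan_mean_set0 step s F : scan_mean step s set0 F = F s.
Proof. by rewrite /scan_mean cards0 enum_set0 big_seq1 invr1 mul1r. Qed.

Lemma card_scan_mean step s U F :
  #|U|%:R * scan_mean step s U F =
  \sum_(v in U) scan_mean step (step s v) (U :\ v) F.
Proof.
have [->|U0] := eqVneq U set0; first by rewrite cards0 mul0r big_set0.
rewrite /scan_mean big_permutations_enum // !mulr_sumr; apply: eq_bigr => v vU.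
rewrite (cardsD1 v U) vU add1n factS natrM invfM !mulrA divff ?mul1r //.
by rewrite pnatr_eq0.
Qed.

Definition skip v step s w : St := if w == v then s else step s w.

Lemma scan_mean_skip step v s U F :
  scan_mean (skip v step) s U F = scan_mean step s (U :\ v) F.
Proof.
elim/setD1_ind: U s => U IH s.
have [->|U0] := eqVneq U set0; first by rewrite set0D !scan_mean_set0.
have cardU0 : #|U|%:R != 0 :> R by rewrite pnatr_eq0 cards_eq0.
apply: (mulfI cardU0); rewrite card_scan_mean.
under eq_bigr => w wU do rewrite IH // setD1C.
have sum_skip : \sum_(w in U :\ v)
    scan_mean step (skip v step s w) (U :\ v :\ w) F =
    #|U :\ v|%:R * scan_mean step s (U :\ v) F.
  rewrite card_scan_mean; apply: eq_bigr => w /setD1P[/negbTE wv _].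
  by rewrite /skip wv.
have [vU|vU] := boolP (v \in U); last first.
  by move: sum_skip; rewrite (setDidPl _) // disjoint_sym disjoints1.
rewrite (big_setD1 v) //= sum_skip (cardsD1 v U) vU natrD mulrDl mul1r.
by rewrite /skip eqxx setDDl setUid.
Qed.

(* The conditional means along the scan form a martingale whose increments are
   bounded by [C]. *)
Lemma scan_mean_sqr_dist_le step (C c : R) s U F :
  (forall s' W v, v \in W ->
    `|scan_mean step (step s' v) (W :\ v) F - scan_mean step s' W F| <= C) ->
  scan_mean step s U (fun s' => (F s' - c) ^+ 2) <=
  #|U|%:R * C ^+ 2 + (scan_mean step s U F - c) ^+ 2.
Proof.
move=> increment; elim/setD1_ind: U s => U IH s.
have [->|U0] := eqVneq U set0.
  by rewrite !scan_mean_set0 cards0 mul0r add0r.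
have cardU : 0 < #|U|%:R :> R by rewrite ltr0n card_gt0.
rewrite -(ler_pM2l cardU) card_scan_mean.
apply: le_trans (ler_sum _ (fun v vU => IH v vU (step s v))) _.
rewrite big_split /=.
rewrite (sum_sqr_dist_mean c (esym (card_scan_mean step s U F))) mulrDr addrA.
rewrite lerD2r -big_split /= [leRHS]mulr_natl -sumr_const.
apply: ler_sum => v vU.
rewrite (cardsD1 v U) vU addnC natrD mulrDl mul1r lerD2l.
have norm_le := increment s U v vU.
rewrite -[leLHS]real_normK ?num_real // lerXn2r ?nnegrE //.
exact: le_trans norm_le.
Qed.

End ScanMean.

Section Paths.
Variables (R : realFieldType) (T : finType) (adj : rel T).
Implicit Types (x v w : T) (U : {set T}).

(* The number of paths of length [j] issued from [x] with distinct further
   vertices in [U]. *)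
Fixpoint npaths j x U : nat :=
  if j is j'.+1 then (\sum_(v in U | adj x v) npaths j' v (U :\ v))%N else 1%N.

Lemma sum_npaths_setD1 j x U :
  (\sum_(v in U) npaths j x (U :\ v) + j * npaths j x U =
   #|U| * npaths j x U)%N.
Proof.
elim: j x U => [|j IH] x U /=; first by rewrite sum_nat_const mul0n addn0.
rewrite (exchange_big_setD1 U (adj x) (fun v w => npaths j w (U :\ v :\ w))) /=.
rewrite !big_distrr -big_split /=; apply: eq_bigr => w /andP[wU _].
under eq_bigr => v _ do rewrite setD1C.
by rewrite mulSn addnCA IH (cardsD1 w U) wU mulnDl mul1n.
Qed.

Lemma npaths_le D j x U :
  (forall y, #|[set w | adj y w]| <= D)%N -> (npaths j x U <= D ^ j)%N.
Proof.
move=> deg_le; elim: j x U => //= j IH x U.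
apply: (@leq_trans (\sum_(v in U | adj x v) D ^ j)%N).
  by apply: leq_sum => v _; exact: IH.
rewrite sum_nat_const expnS leq_mul2r; apply/orP; right.
apply: leq_trans (deg_le x); apply/subset_leq_card/subsetP => w.
by rewrite !inE => /andP[].
Qed.

(* In a uniformly random order of [U], a given path of length [j] is increasing
   with probability [1 / j!]. *)
Definition mean_increasing_paths j x U : R := (npaths j x U)%:R / (j`!)%:R.

Lemma mean_increasing_paths_ge0 j x U : 0 <= mean_increasing_paths j x U.
Proof. by rewrite divr_ge0. Qed.

Lemma sum_mean_increasing_paths_setD1 j x U :
  \sum_(w in U) mean_increasing_paths j x (U :\ w) =
  (#|U|%:R - j%:R) * mean_increasing_paths j x U.
Proof.
rewrite -mulr_suml -natr_sum mulrA mulrBl -!natrM -sum_npaths_setD1.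
by rewrite natrD addrK.
Qed.

Lemma sum_mean_increasing_paths_adj j x U :
  \sum_(w in U | adj x w) mean_increasing_paths j w (U :\ w) =
  j.+1%:R * mean_increasing_paths j.+1 x U.
Proof.
rewrite -mulr_suml -natr_sum /mean_increasing_paths factS natrM invfM.
by rewrite [RHS]mulrCA mulVKf ?pnatr_eq0.
Qed.

Definition influence x U : R :=
  \sum_(j < #|U|.+1) mean_increasing_paths j x U.

Lemma influence_ge0 x U : 0 <= influence x U.
Proof. by apply: sumr_ge0 => j _; exact: mean_increasing_paths_ge0. Qed.

Lemma influence_set0 x : influence x set0 = 1.
Proof. by rewrite /influence cards0 big_ord1 /mean_increasing_paths divr1. Qed.

Lemma influence_setD1 x U w : w \in U ->
  influence x (U :\ w) = \sum_(j < #|U|) mean_increasing_paths j x (U :\ w).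
Proof. by move=> wU; rewrite /influence (cardsD1 w U) wU. Qed.

Lemma sum_influence_setD1 x U :
  \sum_(w in U) influence x (U :\ w) +
  \sum_(w in U | adj x w) influence w (U :\ w) = #|U|%:R * influence x U.
Proof.
have -> : \sum_(w in U) influence x (U :\ w) =
    \sum_(j < #|U|.+1) (#|U|%:R - j%:R) * mean_increasing_paths j x U.
  under eq_bigr => w wU do rewrite influence_setD1 //.
  rewrite exchange_big big_ord_recr /= subrr mul0r addr0.
  by apply: eq_bigr => j _; rewrite sum_mean_increasing_paths_setD1.
have -> : \sum_(w in U | adj x w) influence w (U :\ w) =
    \sum_(j < #|U|.+1) j%:R * mean_increasing_paths j x U.
  under eq_bigr => w /andP[wU _] do rewrite influence_setD1 //.
  rewrite exchange_big [RHS]big_ord_recl mul0r add0r /=.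
  by apply: eq_bigr => j _; rewrite sum_mean_increasing_paths_adj.
rewrite -big_split mulr_sumr; apply: eq_bigr => j _.
by rewrite /= -mulrDl subrK.
Qed.

Lemma influence_le D x U : (forall y, #|[set w | adj y w]| <= D)%N ->
  influence x U <= \sum_(j < #|U|.+1) D%:R ^+ j / (j`!)%:R.
Proof.
move=> deg_le; apply: ler_sum => j _.
by rewrite ler_wpM2r ?invr_ge0 // -natrX ler_nat npaths_le.
Qed.

End Paths.

Section LocalSelection.
Variables (R : realFieldType) (T : finType) (adj : rel T).
Variable accepts : {set T} -> T -> bool.
Hypothesis accepts_local :
  forall S w, accepts S w = accepts [set x in S | adj x w] w.
Implicit Types (v w : T) (D S U : {set T}) (o : seq T).

Definition select S w : {set T} := if accepts S w then w |: S else S.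

Definition agree_off D S1 S2 : Prop :=
  forall x, x \notin D -> (x \in S1) = (x \in S2).

(* The vertices at which two selections may differ after processing [w], if they
   differ only on [D] before. *)
Definition spread D w : {set T} :=
  if [exists x in D, adj x w] then w |: D else D.

Lemma subset_spread D w : D \subset spread D w.
Proof. by rewrite /spread; case: ifP => // _; exact: subsetU1. Qed.

Lemma accepts_agree_off D S1 S2 w :
  agree_off D S1 S2 -> ~~ [exists x in D, adj x w] ->
  accepts S1 w = accepts S2 w.
Proof.
move=> agree /existsPn nadj; rewrite accepts_local [RHS]accepts_local.
congr accepts; apply/setP => x; rewrite !inE.
have := nadj x; have [_ /= /negbTE->|xD _] := boolP (x \in D).
  by rewrite !andbF.
by rewrite agree.
Qed.

Lemma select_neq S w x : x != w -> (x \in select S w) = (x \in S).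
Proof. by rewrite /select; case: ifP; rewrite // !inE => _ /negbTE->. Qed.

Lemma agree_off_skip_select v D S1 S2 w : v \in D -> agree_off D S1 S2 ->
  agree_off (spread D w) (skip v select S1 w) (select S2 w).
Proof.
move=> vD agree x xD'.
have xD : x \notin D by apply: contra xD'; exact/subsetP/subset_spread.
rewrite /skip; have [xw|xw] := eqVneq x w; last first.
  by case: ifP => _; rewrite !select_neq // agree.
have /negbTE-> : w != v by apply: contraNneq xD => wv; rewrite xw wv.
have nadj : ~~ [exists y in D, adj y w].
  by apply: contra xD' => adjw; rewrite /spread adjw xw setU11.
rewrite /select (accepts_agree_off agree nadj).
by case: ifP => _; rewrite ?inE agree.
Qed.

Lemma agree_off_foldl v D S1 S2 o : v \in D -> agree_off D S1 S2 ->
  agree_off (foldl spread D o) (foldl (skip v select) S1 o) (foldl select S2 o).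
Proof.
elim: o D S1 S2 => //= w o IH D S1 S2 vD agree.
apply: IH; first exact: (subsetP (subset_spread D w)).
exact: agree_off_skip_select.
Qed.

Lemma sum_spread_le D w (f : T -> R) : (forall x, 0 <= f x) ->
  \sum_(x in spread D w) f x <=
  \sum_(x in D) (f x + if adj x w then f w else 0).
Proof.
move=> f0; have term0 x : 0 <= if adj x w then f w else 0 by case: ifP.
rewrite big_split /= /spread.
case: ifPn => [/existsP[y /andP[yD yw]]|_]; last by rewrite lerDl sumr_ge0.
have [wD|wD] := boolP (w \in D).
  by rewrite (setUidPr _) ?sub1set // lerDl sumr_ge0.
by rewrite big_setU1 //= addrC lerD2l (bigD1 y) //= yw lerDl sumr_ge0.
Qed.

Lemma scan_mean_card_spread D U :
  scan_mean spread D U (fun D' => #|D'|%:R) <=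
  \sum_(x in D) influence R adj x U.
Proof.
elim/setD1_ind: U D => U IH D.
have [->|U0] := eqVneq U set0.
  rewrite scan_mean_set0; under eq_bigr => x _ do rewrite influence_set0.
  by rewrite sumr_const.
have cardU : 0 < #|U|%:R :> R by rewrite ltr0n card_gt0.
rewrite -(ler_pM2l cardU) card_scan_mean.
apply: le_trans (ler_sum _ (fun w wU => IH w wU (spread D w))) _.
apply: le_trans (ler_sum _ (fun w _ => sum_spread_le D w
  (fun x => influence_ge0 R adj x (U :\ w)))) _.
rewrite exchange_big mulr_sumr /=; apply: ler_sum => x _.
by rewrite -sum_influence_setD1 big_split /= big_mkcondr.
Qed.

Definition unit_lipschitz (F : {set T} -> R) : Prop :=
  forall D S1 S2, agree_off D S1 S2 -> `|F S1 - F S2| <= #|D|%:R.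

Lemma card_unit_lipschitz : unit_lipschitz (fun S => #|S|%:R).
Proof.
have card_le D S1 S2 : agree_off D S1 S2 -> (#|S1| <= #|S2| + #|D|)%N.
  move=> agree; apply: leq_trans (leq_card_setU _ _).
  apply/subset_leq_card/subsetP => x xS; rewrite inE.
  by have [|xD] := boolP (x \in D); rewrite ?orbT // -agree ?xS.
move=> D S1 S2 agree; rewrite ler_distl lerBlDr -!natrD !ler_nat.
by rewrite !card_le // => x xD; rewrite agree.
Qed.

(* By [scan_mean_skip], both scans can be run along the same random order of
   [U], the first one skipping [v]. *)
Lemma dist_scan_mean_select_le F S U v : unit_lipschitz F ->
  `|scan_mean select (select S v) (U :\ v) F - scan_mean select S U F| <=
  influence R adj v U.
Proof.
move=> lipF; rewrite -scan_mean_skip.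
apply: le_trans (_ : scan_mean spread [set v] U (fun D => #|D|%:R) <= _).
  apply: ler_dist_scan_mean => o; apply/lipF/agree_off_foldl; rewrite ?set11 //.
  by move=> x; rewrite inE => /select_neq.
by apply: le_trans (scan_mean_card_spread _ _) _; rewrite big_set1.
Qed.

Lemma scan_select_variance_le F (C : R) S U : unit_lipschitz F ->
  (forall v W, influence R adj v W <= C) ->
  scan_mean select S U (fun S' => (F S' - scan_mean select S U F) ^+ 2) <=
  #|U|%:R * C ^+ 2.
Proof.
move=> lipF influence_leC; set mu := scan_mean select S U F.
apply: le_trans (scan_mean_sqr_dist_le (C := C) mu _ _ _) _.
  move=> S' W v _; apply: le_trans (influence_leC v W).
  exact: dist_scan_mean_select_le.
by rewrite subrr expr0n addr0.
Qed.

End LocalSelection.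

Section HypergraphSelection.
Variables (T : finType) (G : hypergraph T).
Implicit Types (x v w : T) (S U : {set T}).

Definition adjacent x w : bool :=
  (x != w) && [exists e in edges G, (x \in e) && (w \in e)].

Definition addable S w : bool :=
  ~~ [exists e in edges G, (w \in e) && (e :\ w \subset S)].

Lemma card_adjacent r x :
  uniform r.+1 G -> (#|[set w | adjacent x w]| <= max_degree G * r)%N.
Proof.
move=> unif; pose Ex := [set e in edges G | x \in e].
have sub : [set w | adjacent x w] \subset \bigcup_(e in Ex) (e :\ x).
  apply/subsetP => w; rewrite inE => /andP[xw /existsP[e /and3P[eG xe we]]].
  by apply/bigcupP; exists e; rewrite !inE ?eG // eq_sym xw.
apply: leq_trans (subset_leq_card sub) _.
apply: leq_trans (leq_card_bigcup _ _) _.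
rewrite (eq_bigr (fun=> r)) => [|e].
  by rewrite sum_nat_const leq_mul2r (leq_bigmax (F := degree G) x) orbT.
by rewrite inE => /andP[/unif + xe]; rewrite (cardsD1 x) xe => -[].
Qed.

Lemma addable_local S w : addable S w = addable [set x in S | adjacent x w] w.
Proof.
congr (~~ _); apply: eq_existsb => e; have [eG|//] := boolP (e \in edges G).
have [we /=|//] := boolP (w \in e).
rewrite setIdE subsetI andb_idr // => _; apply/subsetP => x /setD1P[xw xe].
by rewrite inE /adjacent xw; apply/existsP; exists e; rewrite eG xe.
Qed.

Lemma addable_subset S S' w : S \subset S' -> addable S' w -> addable S w.
Proof.
move=> sub; apply: contra => /existsP[e /and3P[eG we eS]].
by apply/existsP; exists e; rewrite eG we (subset_trans eS).
Qed.

Lemma addableE S w : independent G S ->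
  addable S w = ~~ [exists e in edges G, e \subset S :|: [set w]].
Proof.
move=> indS; congr (~~ _); apply: eq_existsb => e.
have [eG|//] := boolP (e \in edges G); rewrite setUC -subDset /=.
have [//|we] := boolP (w \in e); rewrite (setDidPl _) ?(negbTE (indS e eG)) //.
by rewrite disjoint_sym disjoints1.
Qed.

Lemma independent_setU1 S v :
  independent G S -> addable S v -> independent G (v |: S).
Proof.
move=> indS; rewrite addableE // => /existsPn nsub e eG.
by have := nsub e; rewrite eG setUC.
Qed.

Lemma remaining_after_addable S U v : independent G S -> addable S v ->
  remaining_after G S [set w in U | addable S w] v =
  [set w in U :\ v | addable (v |: S) w].
Proof.
move=> indS addv; apply/setP => w.
rewrite !inE -addableE; last exact: independent_setU1.
have [addw|_] := boolP (addable (v |: S) w); last by rewrite !andbF.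
by rewrite (addable_subset _ addw) ?subsetUr // !andbT.
Qed.

Lemma addable_set0 w : (forall e, e \in edges G -> (1 < #|e|)%N) ->
  addable set0 w.
Proof.
move=> card_gt1; apply/existsPn => e; apply/negP => /and3P[eG we].
rewrite subset0 => /eqP ew0; have := card_gt1 e eG.
by rewrite (cardsD1 w e) we ew0 cards0.
Qed.

End HypergraphSelection.

Section GreedyScan.
Variables (R : realFieldType) (T : finType) (G : hypergraph T).
Implicit Types (S U Rem : {set T}) (F : {set T} -> R).

Definition greedy_mean_from k S Rem F : R :=
  \sum_I greedy_from R G k S Rem I * F I.

Lemma greedy_mean_from_set0 k S F : greedy_mean_from k S set0 F = F S.
Proof.
rewrite /greedy_mean_from (bigD1 S) //= big1 => [|I /negbTE IS]; last first.
  by case: k => [|k] /=; rewrite eqxx IS mul0r.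
by case: k => [|k] /=; rewrite !eqxx mul1r addr0.
Qed.

Lemma card_greedy_mean_from k S Rem F :
  #|Rem|%:R * greedy_mean_from k.+1 S Rem F =
  \sum_(v in Rem) greedy_mean_from k (v |: S) (remaining_after G S Rem v) F.
Proof.
have [->|Rem0] := eqVneq Rem set0; first by rewrite cards0 mul0r big_set0.
rewrite /greedy_mean_from exchange_big mulr_sumr /=; apply: eq_bigr => I _.
by rewrite (negbTE Rem0) -mulrA mulVKf ?mulr_suml // pnatr_eq0 cards_eq0.
Qed.

(* Scanning a vertex that is not addable leaves the state unchanged, so
   conditioning on the next addable vertex makes it uniform among the remaining
   ones. *)
Lemma greedy_mean_from_scan k S U F : independent G S -> (#|U| <= k)%N ->
  greedy_mean_from k S [set w in U | addable G S w] F =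
  scan_mean (select (addable G)) S U F.
Proof.
elim/setD1_ind: U k S => U IH k S indS Uk; set Rem := [set w in U | _].
have [U0|U0] := eqVneq U set0.
  have -> : Rem = set0 by apply/setP => w; rewrite !inE U0 inE.
  by rewrite U0 greedy_mean_from_set0 scan_mean_set0.
have cardU0 : #|U|%:R != 0 :> R by rewrite pnatr_eq0 cards_eq0.
case: k Uk => [|k] Uk; first by rewrite leqn0 cards_eq0 (negbTE U0) in Uk.
have cardUD1 v : v \in U -> (#|U :\ v| <= k)%N.
  by move=> vU; rewrite (cardsD1 v) vU in Uk.
pose g := greedy_mean_from k.+1 S Rem F; pose sel := select (addable G).
have scan_addable : \sum_(v in U | addable G S v)
    scan_mean sel (sel S v) (U :\ v) F = #|Rem|%:R * g.
  rewrite card_greedy_mean_from; apply: eq_big => [v|v /andP[vU addv]].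
    by rewrite inE.
  rewrite remaining_after_addable // IH ?cardUD1 //; last first.
    exact: independent_setU1.
  by rewrite /sel /select addv.
have scan_not_addable : \sum_(v in U | ~~ addable G S v)
    scan_mean sel (sel S v) (U :\ v) F = #|U :\: Rem|%:R * g.
  rewrite mulr_natl -sumr_const; apply: eq_big => [v|v /andP[vU /negbTE addv]].
    by rewrite !inE; case: (v \in U); rewrite ?andbT.
  rewrite {2}/sel /select addv -(IH v vU k.+1) ?leqW ?cardUD1 //.
  congr greedy_mean_from; apply/setP => w; rewrite !inE.
  by have [->|//] := eqVneq w v; rewrite addv !andbF.
apply: (mulfI cardU0); rewrite card_scan_mean (bigID (addable G S)) /=.
rewrite scan_addable scan_not_addable -mulrDl -natrD; congr (_%:R * _).
rewrite -(cardsID Rem U) (setIidPr _) //.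
by apply/subsetP => w; rewrite inE => /andP[].
Qed.

Lemma greedy_mean_scan F : (forall e, e \in edges G -> (1 < #|e|)%N) ->
  greedy_mean G F = scan_mean (select (addable G)) set0 [set: T] F.
Proof.
move=> card_gt1; rewrite -(greedy_mean_from_scan (k := #|T|)) ?cardsT //.
  by congr greedy_mean_from; apply/setP => w; rewrite !inE addable_set0.
by move=> e /edges_nonempty; apply: contra; rewrite subset0.
Qed.

Lemma greedy_chebyshev F (m t : R) : 0 <= t ->
  t ^+ 2 * greedy_prob R G (fun S => t < `|F S - m|) <=
  greedy_mean G (fun S => (F S - m) ^+ 2).
Proof.
move=> t0; rewrite /greedy_prob mulr_sumr big_mkcond /=.
apply: ler_sum => S _; rewrite mulrC.
case: ifP => [/ltW t_le|_]; last by rewrite mulr_ge0 ?greedy_law_ge0 ?sqr_ge0.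
rewrite ler_wpM2l ?greedy_law_ge0 // -[leRHS]real_normK ?num_real //.
by rewrite lerXn2r ?nnegrE.
Qed.

End GreedyScan.

From mathcomp Require Import all_classical all_reals all_analysis.

Import numFieldNormedType.Exports.
Local Open Scope classical_set_scope.

Lemma exp_sum_le_expR (R : realType) (x : R) (k : nat) : 0 <= x ->
  \sum_(j < k) x ^+ j / (j`!)%:R <= expR x.
Proof.
move=> x0.
rewrite -(big_mkord xpredT (exp_coeff x)).
apply: (nondecreasing_cvgn_le _ (is_cvg_series_exp_coeff x) k).
by apply: nondecreasing_series => n _ _; exact: exp_coeff_ge0.
Qed.

Lemma sup_ge0_le (R : realType) (E : set R) (c : R) : 0 <= c ->
  (forall p, E p -> 0 <= p <= c) -> 0 <= sup E <= c.
Proof.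
move=> c0 E_itv; have [->|/set0P E0] := eqVneq E set0.
  by rewrite sup0 lexx c0.
have ubE : ubound E c by move=> p /E_itv/andP[].
rewrite ge_sup // andbT; case: (E0) => p Ep.
case/andP: (E_itv p Ep) => p0 _; apply: le_trans p0 _.
by apply: ub_le_sup Ep; exists c.
Qed.

Lemma greedy_variance_le (R : realType) (T : finType) (G : hypergraph T)
    (r : nat) (mu := greedy_mean G (fun S => #|S|%:R) : R) :
  (0 < r)%N -> uniform r.+1 G ->
  greedy_mean G (fun S => (#|S|%:R - mu) ^+ 2) <=
  #|T|%:R * expR (max_degree G * r)%:R ^+ 2.
Proof.
move=> r0 unif; have card_gt1 e : e \in edges G -> (1 < #|e|)%N by move/unif->.
rewrite {}/mu !greedy_mean_scan // -cardsT.
apply: (scan_select_variance_le (addable_local G)) => [|v W].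
  exact: card_unit_lipschitz.
apply: le_trans (influence_le R v W (fun x => card_adjacent x unif)) _.
exact: exp_sum_le_expR.
Qed.

Lemma greedy_tail_le (R : realType) (T : finType) (G : hypergraph T) (r : nat)
    (t : R) : (0 < #|T|)%N -> (0 < r)%N -> uniform r.+1 G -> 0 < t ->
  greedy_prob R G (fun S => Num.sqrt #|T|%:R * t <
    `|#|S|%:R - greedy_mean G (fun S' => #|S'|%:R)|) <=
  (expR (max_degree G * r)%:R / t) ^+ 2.
Proof.
move=> T0 r0 unif t0.
have dev_ge0 : 0 <= Num.sqrt #|T|%:R * t by rewrite mulr_ge0 ?sqrtr_ge0 // ltW.
have variance_le := greedy_variance_le R r0 unif.
have := le_trans (greedy_chebyshev G _ _ dev_ge0) variance_le.
rewrite exprMn sqr_sqrtr // -mulrA ler_pM2l ?ltr0n //.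
by rewrite expr_div_n ler_pdivlMr ?exprn_gt0 // mulrC.
Qed.

Theorem theorem5 (R : realType) (r d : nat) (hr : (1 <= r)%N) (hd : (2 <= d)%N)
    (b : nat -> R) (hb_pos : forall n : nat, 0 < b n)
    (hb_lim : b n @[n --> \oo] --> +oo) :
  sup [set p : R | exists (T : finType) (G : hypergraph T),
         [/\ #|T| = n, uniform r.+1 G, linear_hypergraph G, max_degree G = d &
             p = greedy_prob R G (fun S : {set T} =>
                   Num.sqrt n%:R * b n <
                   `| #|S|%:R - greedy_mean G (fun S' : {set T} => #|S'|%:R) |)]]
    @[n --> \oo] --> (0 : R).
Proof.
pose C : R := expR (d * r)%:R.
apply: (@squeeze_cvgr _ _ _ _ (fun=> 0) (fun n => (C / b n) ^+ 2)).
- near=> n; apply: sup_ge0_le => [|p]; first exact: sqr_ge0.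
  move=> [T [G [cardT unif _ maxdeg ->]]]; rewrite greedy_prob_ge0 /=.
  rewrite /C -maxdeg -{1}cardT; apply: greedy_tail_le => //.
  by rewrite cardT; near: n; exact: nbhs_infty_gt.
- exact: cvg_cst.
- have binv : (b n)^-1 @[n --> \oo] --> (0 : R).
    by apply/gtr0_cvgV0 => //; exact: nearW.
  have Cb : C / b n @[n --> \oo] --> (0 : R).
    by rewrite -(mulr0 C); exact: cvgM (cvg_cst _) binv.
  by rewrite -(mulr0 0); exact: cvgM.
Unshelve. all: by end_near.
Qed.
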